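(* Let $(a_n)_{n\in\mathbb N}$ be a Cauchy sequence of real numbers, let $E=\{a_n \mid n\in\mathbb N\}\subseteq\mathbb R$, and let $\Lambda$ be the set of all real scalar functions on $\mathbb R$. Then the structure $(\mathbb R,<,+,0,\Lambda,E)$ is d-minimal.
   Context: The real scalar functions on $\mathbb R$ are the maps $x\mapsto \lambda x$, $\lambda\in\mathbb R$; thus $(\mathbb R,<,+,0,\Lambda)$ is the ordered $\mathbb R$-vector space structure over $\mathbb R$, and $(\mathbb R,<,+,0,\Lambda,E)$ is its first-order expansion by a unary predicate for $E$. ''Definable'' means definable with parameters. A subset of a topological space is discrete if its subspace topology is discrete. An expansion $\mathcal R$ of the ordered set of reals $(\mathbb R,<)$ is d-minimal if either one of (equivalently, both of) the following equivalent conditions holds: (1) for every $\mathcal M\equiv\mathcal R$ with universe $M$, every subset of $M$ definable in $\mathcal M$ is the union of an open set and finitely many discrete sets; (2) for every nonnegative integer $n$ and every definable set $A\subseteq\mathbb R^{n+1}$ there exists a positive integer $N$ such that for each $x\in\mathbb R^n$ the fiber $A_x:=\{y\in\mathbb R\mid (x,y)\in A\}$ either has nonempty interior or is the union of at most $N$ discrete sets. *)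

(* Defs.v *)
From HB Require Import structures.
From mathcomp Require Import all_boot all_order all_algebra.
From mathcomp Require Import all_classical all_reals all_analysis.

Set Implicit Arguments.
Unset Strict Implicit.
Unset Printing Implicit Defensive.

Import Order.TTheory GRing.Theory Num.Theory.
Import numFieldNormedType.Exports.

Local Open Scope classical_set_scope.
Local Open Scope ring_scope.

(* First-order structures expanding the ordered set (R, <).  Equality and the
   order are logical symbols (see [formula]), so a [language] lists only the
   additional function and relation symbols, with their arities. *)
Record language := Language {
  fun_sym : Type;
  fun_ar : fun_sym -> nat;
  rel_sym : Type;
  rel_ar : rel_sym -> nat }.

Record expansion (L : language) (R : realType) := Expansion {
  fun_int : forall f : fun_sym L, (fun_ar f).-tuple R -> R;
  rel_int : forall P : rel_sym L, set ((rel_ar P).-tuple R) }.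

(* Variables are de Bruijn indices; [All] binds index 0.  The remaining
   connectives and the existential quantifier are definable classically. *)
Inductive term (L : language) : Type :=
| Var of nat
| App (f : fun_sym L) of ('I_(fun_ar f) -> term L).

Inductive formula (L : language) : Type :=
| Falsum
| Eq of term L & term L
| Lt of term L & term L
| Rel (P : rel_sym L) of ('I_(rel_ar P) -> term L)
| Imp of formula L & formula L
| All of formula L.

Section Semantics.
Variables (L : language) (R : realType) (S : expansion L R).

Definition scons (x : R) (v : nat -> R) : nat -> R :=
  fun i => if i is j.+1 then v j else x.

Fixpoint eval (v : nat -> R) (t : term L) : R :=
  match t with
  | Var i => v i
  | App f ts => fun_int S [tuple eval v (ts i) | i < fun_ar f]
  end.

Fixpoint sat (v : nat -> R) (phi : formula L) : Prop :=
  match phi with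
  | Falsum => False
  | Eq t u => eval v t = eval v u
  | Lt t u => eval v t < eval v u
  | Rel P ts => rel_int S [tuple eval v (ts i) | i < rel_ar P]
  | Imp p q => sat v p -> sat v q
  | All p => forall x : R, sat (scons x v) p
  end.

(* Indices i < n denote the coordinates of x, and index n + k denotes the
   parameter p k. *)
Definition assign n (x : n.-tuple R) (p : nat -> R) : nat -> R :=
  fun i => nth (p (i - n)%N) x i.

(* Definability with parameters: a formula mentions finitely many variables,
   hence only finitely many of the p k. *)
Definition definable n (A : set (n.-tuple R)) : Prop :=
  exists (phi : formula L) (p : nat -> R),
    forall x : n.-tuple R, A x <-> sat (assign x p) phi.

End Semantics.

(* The subspace topology on A is discrete: every subset of A is relatively
   open. *)
Definition discrete_set (T : topologicalType) (A : set T) : Prop :=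
  forall B : set T, B `<=` A -> exists2 U : set T, open U & B = A `&` U.

(* Unions of at most N discrete sets; the empty set is discrete, so exactly N
   sets, possibly with repetitions, may be required. *)
Definition union_of_discrete (T : topologicalType) (N : nat) (A : set T) :
    Prop :=
  exists2 D : 'I_N -> set T,
    forall i, discrete_set (D i) & A = \bigcup_(i in [set: 'I_N]) D i.

Definition fiber (R : realType) n (A : set (n.+1.-tuple R)) (x : n.-tuple R) :
    set R :=
  [set y | A [tuple of rcons x y]].

(* d-minimality, through uniform bounds on the fibers of definable sets. *)
Definition dminimal (L : language) (R : realType) (S : expansion L R) : Prop :=
  forall (n : nat) (A : set (n.+1.-tuple R)), definable S A ->
    exists2 N : nat, (0 < N)%N &
      forall x : n.-tuple R,
        interior (fiber A x) !=set0 \/ union_of_discrete N (fiber A x).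

(* The language of ordered R-vector spaces with a unary predicate. *)
Variant vs_fun (R : realType) : Type := Zero | Add | Scal of R.

Definition vs_fun_ar (R : realType) (f : vs_fun R) : nat :=
  match f with Zero => 0%N | Add => 2%N | Scal _ => 1%N end.

Definition vs_language (R : realType) : language :=
  @Language (vs_fun R) (@vs_fun_ar R) unit (fun _ => 1%N).

Definition vs_fun_int (R : realType) (f : vs_fun R) :
    (vs_fun_ar f).-tuple R -> R :=
  match f with
  | Zero => fun _ => 0
  | Add => fun t => t`_0 + t`_1
  | Scal lambda => fun t => lambda * t`_0
  end.

(* The structure (R, <, +, 0, Lambda, E). *)
Definition vs_expansion (R : realType) (E : set R) :
    expansion (vs_language R) R :=
  @Expansion (vs_language R) R (@vs_fun_int R) (fun _ t => E t`_0).

(* Main.v *)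
Require Import Defs.
From mathcomp Require Import all_boot all_order all_algebra.
From mathcomp Require Import all_classical all_reals all_analysis.
From mathcomp Require Import ring lra.

(** Let l be the limit of the sequence and K = E `|` {l}.  The set K is compact
    and all its points but l are isolated, so it has finite Cantor-Bendixson
    rank.  Compact sets of finite rank are stable under finite unions, products
    and continuous images, hence under D, C |-> c D and D - C; and every subset
    of a set of rank r is a union of r discrete sets.

    Say that u and u' have the same cut in D if they compare in the same way
    with every element of D.  The main claim ([tame_sat]) is a weak form of
    quantifier elimination: for each formula there are finitely many linear
    forms f_i in the variables and compact sets D_i of finite rank such that the
    truth value of the formula at v depends only on the cuts of the f_i v in
    the D_i.  For atomic formulas, take D = {0} for the order and equality, and
    D = K for the predicate.  For the quantifier over y ([tame_all]), divide
    each f_i by its coefficient in y, so that the cuts of y + h_i v in D_i are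
    at stake, and argue as in Fourier-Motzkin elimination: comparing all the
    h_j v - h_i v with the elements of D_j - D_i determines the order pattern of
    the union of the D_i - h_i v.  Compactness makes this sufficient: a point
    outside that union lies in a gap whose end points, if any, belong to the
    union, and a gap is transported to a nonempty gap by any order isomorphism.

    Fix now all the variables but y.  A definable set of reals y is then
    determined by the cuts of finitely many F_i y = m_i y + c_i in D_i, where
    only c_i depends on the other variables.  If it contains a point y such that
    F_i y is outside the closed set D_i whenever m_i is nonzero, then it
    contains a neighbourhood of y.  Otherwise it is covered by the preimages F_i^-1 D_i
    with m_i nonzero, and the number of discrete sets needed is bounded by the
    sum of the ranks of the D_i ([tame_line]). *)

Set Implicit Arguments.
Unset Strict Implicit.
Unset Printing Implicit Defensive.

Import Order.TTheory GRing.Theory Num.Theory.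
Import numFieldNormedType.Exports.

Local Open Scope classical_set_scope.
Local Open Scope ring_scope.

(** * Compact sets of finite Cantor-Bendixson rank *)

(** X1 may be any set of finite rank that contains the accumulation points of
    X; not asking for X1 to be the derived set, nor even a subset of X, spares
    the computation of derived sets of unions, products and images. *)
Inductive finite_rank (T : topologicalType) : set T -> Prop :=
| finite_rank0 : finite_rank set0
| finite_rankS (X X1 : set T) : compact X -> finite_rank X1 ->
    (forall x, X x -> ~ X1 x -> \forall y \near x, X y -> y = x) ->
    finite_rank X.

Lemma finite_rank_compact (T : topologicalType) (X : set T) :
  finite_rank X -> compact X.
Proof. by case=> [|{}X X1 cX _ _]; [exact: compact0|exact: cX]. Qed.

Lemma finite_rank_closed (T : topologicalType) (X : set T) :
  hausdorff_space T -> finite_rank X -> closed X.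
Proof. by move=> hT /finite_rank_compact; apply: compact_closed. Qed.

Lemma finite_rank1 (T : topologicalType) (x : T) : finite_rank [set x].
Proof.
refine (finite_rankS (@compact_set1 _ x) (finite_rank0 _) _) => y /= -> _.
by near=> z.
Unshelve. all: end_near. Qed.

Lemma finite_rankU (T : topologicalType) (X Y : set T) : hausdorff_space T ->
  finite_rank X -> finite_rank Y -> finite_rank (X `|` Y).
Proof.
move=> hT rX rY; elim: rX => [|{}X X1 cX _ IH isoX]; first by rewrite set0U.
apply: finite_rankS IH _; first exact: compactU cX (finite_rank_compact rY).
move=> x XYx nx.
have Xx : X x by case: XYx => // Yx; case: nx; right.
have nYx : (~` Y) x by move=> Yx; apply: nx; right.
have oY : open (~` Y) by apply: closed_openC; apply: finite_rank_closed.
have nX1x : ~ X1 x by move=> X1x; apply: nx; left.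
near=> y.
have nYy : (~` Y) y by near: y; apply: open_nbhs_nbhs.
case=> [|//]; near: y; exact: isoX.
Unshelve. all: end_near. Qed.

(** A point s outside f(X1) has its preimage in X made of isolated points, so
    the rest W of X is compact; then f(W) is closed and misses s, which leaves
    s as the only point of f(X) in a neighbourhood of s. *)
Lemma finite_rank_image (T U : topologicalType) (f : T -> U) (X : set T) :
  hausdorff_space T -> hausdorff_space U -> continuous f ->
  finite_rank X -> finite_rank (f @` X).
Proof.
move=> hT hU cf; elim=> [|{}X X1 cX _ IH isoX].
  by rewrite image_set0; apply: finite_rank0.
have cfX Z : compact Z -> compact (f @` Z).
  by apply: continuous_compact; apply: continuous_subspaceT.
apply: finite_rankS (cfX _ cX) IH _ => _ [x0 Xx0 <-] nX1.
set s := f x0 in nX1 *.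
pose W := [set x | X x /\ f x <> s].
have clW : closed W.
  move=> q clq.
  have Xq : X q.
    by apply: (compact_closed hT cX) => B /clq [z [[Xz _] Bz]]; exists z.
  split=> // fq.
  have nq : ~ X1 q by move=> X1q; apply: nX1; exists q.
  by have [z [[Xz fz] /(_ Xz) zq]] := clq _ (isoX _ Xq nq); rewrite zq in fz.
have cW : compact W by apply: subclosed_compact clW cX _ => x [].
have oW : open (~` (f @` W)).
  by apply: closed_openC; apply: compact_closed hU (cfX _ cW).
have sW : (~` (f @` W)) s by move=> [x [_ fx]].
near=> y => -[x Xx fxy].
have : (~` (f @` W)) y by near: y; apply: open_nbhs_nbhs.
by apply: contra_notP => ys; exists x => //; split=> //; rewrite fxy.
Unshelve. all: end_near. Qed.

(** Outside X1 * Y and X * Y1, a point of the product has both coordinates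
    isolated. *)
Lemma finite_rankX (T U : topologicalType) (X : set T) (Y : set U) :
  hausdorff_space (T * U)%type ->
  finite_rank X -> finite_rank Y -> finite_rank (X `*` Y).
Proof.
move=> hTU rX; elim: rX Y => [|{}X X1 cX _ IHX isoX] Y rY.
  by rewrite set0X; apply: finite_rank0.
elim: rY => [|{}Y Y1 cY rY1 IHY isoY].
  by rewrite setX0; apply: finite_rank0.
have rY : finite_rank Y by apply: finite_rankS cY rY1 isoY.
refine (finite_rankS (@compact_setX _ _ _ _ cX cY)
  (finite_rankU hTU (IHX _ rY) IHY) _).
move=> [x y] [/= Xx Yy] nxy.
have nX1 : ~ X1 x by move=> ?; apply: nxy; left.
have nY1 : ~ Y1 y by move=> ?; apply: nxy; right.
exists ([set x' | X x' -> x' = x], [set y' | Y y' -> y' = y]).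
  by split; [apply: isoX|apply: isoY].
by move=> [x' y'] /= [hx hy] [/hx -> /hy ->].
Qed.

Section RealSets.
Variable R : realType.

Let Rhausdorff : hausdorff_space R. Proof. exact: norm_hausdorff. Qed.

Lemma finite_rank_scale (c : R) (D : set R) :
  finite_rank D -> finite_rank [set c * d | d in D].
Proof.
apply: finite_rank_image => // x.
by apply: cvgM; [apply: cvg_cst|apply: cvg_id].
Qed.

Lemma finite_rankB (D C : set R) : finite_rank D -> finite_rank C ->
  finite_rank [set d - e | d in D & e in C].
Proof.
move=> rD rC; rewrite image2E.
have hRR : hausdorff_space (R * R)%type by exact: norm_hausdorff.
have -> : uncurry (fun x y : R => x - y) = (fun p => p.1 - p.2).
  by apply/funext => -[].
apply: (finite_rank_image hRR Rhausdorff) (finite_rankX hRR rD rC).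
by move=> p; apply: (@cvgB _ R); [apply: cvg_fst|apply: cvg_snd].
Qed.

(** Away from l and y, a neighbourhood of y meets only finitely many terms. *)
Lemma cvg_range_isolated (a : nat -> R) l y : a @ \oo --> l -> y != l ->
  \forall z \near y, ([set l] `|` range a) z -> z = y.
Proof.
move=> al yl.
have e0 : 0 < `|y - l| / 2 by rewrite divr_gt0 // normr_gt0 subr_eq0.
have /cvgrPdist_lt /(_ _ e0) [M _ hM] := al.
have fin_m (m : 'I_M) : \forall z \near y, z = a m -> z = y.
  have [->|/eqP aym] := eqVneq (a m) y; first by near=> z.
  have : nbhs y (~` [set a m]).
    apply: open_nbhs_nbhs; split; last by move=> ?; apply: aym.
    by apply: closed_openC; apply: closed_eq.
  by apply: filterS => z.
have fin := @filter_forall _ _ _ _ (nbhs_filter y) fin_m.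
near=> z => zK; have yz : `|y - z| < `|y - l| / 2.
  by near: z; apply: (@cvgr_dist_lt _ _ _ _ _ id y).
have far b : `|l - b| < `|y - l| / 2 -> z <> b.
  move=> lb zb; have := ler_distD b y l; rewrite -zb in lb *.
  by rewrite (distrC z l); lra.
case: zK => [zl|[m _ zm]]; first by case: (far l) => //; rewrite subrr normr0.
have [Mm|mM] := leqP M m; first by case: (far (a m)) => //; apply: hM.
by apply: (near fin z _ (Ordinal mM)).
Unshelve. all: end_near. Qed.

Lemma finite_rank_cvg_range (a : nat -> R) l : a @ \oo --> l ->
  finite_rank ([set l] `|` range a).
Proof.
move=> al; set K := _ `|` _.
have iso y : y != l -> \forall z \near y, K z -> z = y.
  exact: cvg_range_isolated.
apply: (finite_rankS _ (finite_rank1 l)) => [F PF FK|y Ky /eqP/iso//].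
have [cl|ncl] := pselect (cluster F l); first by exists l; split=> //; left.
(* If F does not cluster at l, it contains the finite set of the terms of
   index less than some M. *)
have [A [B [FA lB AB]]] :
    exists A B, [/\ F A, nbhs l B & ~ (A `&` B !=set0)].
  apply: contrapT => nAB; apply: ncl => A B FA lB; apply: contrapT => AB.
  by apply: nAB; exists A, B.
have [M _ hM] := al _ lB.
have cM : compact (a @` `I_M) by apply/finite_compact/finite_image/finite_II.
have [|x [[m _ <-] clm]] := cM F PF.
  apply: filterS (filterI FA FK) => z [Az [zl|[m _ zm]]].
    by case: AB; exists z; split=> //; rewrite zl; apply: nbhs_singleton.
  have [Mm|mM] := leqP M m; last by exists m.
  by case: AB; exists z; split=> //; rewrite -zm; apply: hM.
by exists (a m); split=> //; right; exists m.
Qed.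

End RealSets.

(** * Finite unions of discrete sets *)

Lemma isolated_discrete_set (T : topologicalType) (X A : set T) : A `<=` X ->
  (forall x, A x -> \forall y \near x, X y -> y = x) -> discrete_set A.
Proof.
move=> AX isoA B BA; exists (interior [set z | X z -> B z]);
  first exact: open_interior.
apply/seteqP; split=> x /=.
  move=> Bx; split; first exact: BA.
  by apply: filterS (isoA _ (BA _ Bx)) => y h /h ->.
by move=> [Ax /nbhs_singleton]; apply; apply: AX.
Qed.

Lemma finite_rank_union_of_discrete (T : topologicalType) (X : set T) :
  finite_rank X -> exists N, forall A, A `<=` X -> union_of_discrete N A.
Proof.
elim=> [|{}X X1 _ _ [N IH] isoX].
  exists 0%N => A; rewrite subset0 => ->; exists (fun=> set0) => [[]//|].
  by apply/seteqP; split=> // x [[]].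
exists N.+1 => A AX.
have [D discD AD] := IH (A `&` X1) (fun x => @proj2 _ _).
exists (fun i => if unlift ord0 i is Some j then D j else A `\` X1).
  move=> i; case: unliftP => [j _|_]; first exact: discD.
  apply: (@isolated_discrete_set _ X) => [x []/AX//|x [/AX Xx /isoX]].
  exact.
apply/seteqP; split=> [x Ax|x [i _]].
  have [X1x|nX1x] := pselect (X1 x); last first.
    by exists ord0 => //; rewrite unlift_none.
  have [j _ Dx] : (\bigcup_(i in setT) D i) x by rewrite -AD.
  by exists (lift ord0 j) => //; rewrite liftK.
case: unliftP => [j _ Dx|_ []//].
by have [] : (A `&` X1) x by rewrite AD; exists j.
Qed.

Lemma discrete_set_preimage (T U : topologicalType) (g : T -> U) (A : set U) :
  continuous g -> injective g -> discrete_set A -> discrete_set (g @^-1` A).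
Proof.
move=> cg ig dA C CA.
have [|V oV gC] := dA (g @` C); first by move=> _ [x /CA Ax <-].
exists (g @^-1` V); first by apply: open_comp => // x _; apply: cg.
apply/seteqP; split=> x.
  move=> Cx; have : (g @` C) (g x) by exists x.
  by rewrite gC.
by move=> [Ax Ux]; have [z Cz /ig <-] : (g @` C) (g x) by rewrite gC.
Qed.

Lemma union_of_discrete_fin (T : topologicalType) (J : finType)
    (D : J -> set T) : (forall j, discrete_set (D j)) ->
  union_of_discrete #|J| (\bigcup_j D j).
Proof.
move=> dD; exists (D \o enum_val) => [i|]; first exact: dD.
apply/seteqP; split=> x [j _ Dx]; last by exists (enum_val j).
by exists (enum_rank j) => //=; rewrite enum_rankK.
Qed.

(** * Cuts in compact sets of reals *)

Section Cuts.
Variable R : realType.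
Implicit Type D : set R.

Definition same_cut D (u u' : R) :=
  forall d, D d -> (u < d) = (u' < d) /\ (d < u) = (d < u').

Lemma same_cut_sym D u u' : same_cut D u u' -> same_cut D u' u.
Proof. by move=> h d /h [-> ->]. Qed.

Lemma same_cut_mem D u u' : same_cut D u u' -> D u -> u' = u.
Proof. by move=> h /h []; rewrite ltxx; case: (ltgtP u u'). Qed.

Lemma same_cut_scale D c u u' : c != 0 ->
  same_cut [set c * d | d in D] (c * u) (c * u') -> same_cut D u u'.
Proof.
move=> c0 h d Dd; have [] : _ := h (c * d) (ex_intro2 _ _ d Dd erefl).
case: (ltgtP c 0) c0 => // c0 _; first by rewrite !ltr_nM2l.
by rewrite !ltr_pM2l.
Qed.

Lemma same_cut_near D u : closed D -> ~ D u ->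
  \forall u' \near u, same_cut D u u'.
Proof.
move=> clD nDu.
have /nbhs_ballP [e /= e0 sub] : nbhs u (~` D).
  by apply: open_nbhs_nbhs; split=> //; apply: closed_openC.
exists e => //= u' /=; rewrite /ball/= ltr_norml => /andP[h1 h2] d Dd.
have : ~ (`|u - d| < e) by move=> h; apply: (sub d).
move/negP; rewrite -leNgt ler_normr => /orP[h|h].
  by split; apply/idP/idP; lra.
by split; apply/idP/idP; lra.
Qed.

(** If each of the families s and t is empty or has an extremal member on the
    side of the other, strict separation of the members leaves room for a
    point. *)
Lemma exists_between (I J : Type) (F : set I) (G : set J)
    (s : I -> R) (t : J -> R) :
  (F !=set0 -> exists2 i, F i & forall k, F k -> s k <= s i) ->
  (G !=set0 -> exists2 j, G j & forall k, G k -> t j <= t k) ->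
  (forall i j, F i -> G j -> s i < t j) ->
  exists y, (forall i, F i -> s i < y) /\ (forall j, G j -> y < t j).
Proof.
move=> maxF minG FG.
have [/maxF[i Fi hi]|F0] := pselect (F !=set0);
have [/minG[j Gj hj]|G0] := pselect (G !=set0).
- have ij := FG i j Fi Gj.
  by exists ((s i + t j) / 2); split=> [k /hi|k /hj]; lra.
- exists (s i + 1); split=> [k /hi|k Gk]; first lra.
  by case: G0; exists k.
- exists (t j - 1); split=> [k Fk|k /hj]; last lra.
  by case: F0; exists k.
- exists 0; split=> [k Fk|k Gk]; first by case: F0; exists k.
  by case: G0; exists k.
Qed.

(** The elimination step: if t_i + d |-> t'_i + d preserves the order between
    the unions of the translates t_i + D_i and t'_i + D_i, then every position
    of y in the first union is also realised in the second one.  When y is not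
    in the first union, that union, being compact, has a largest element below y
    and a smallest one above y (or none), and y' is chosen between the images
    of these two. *)
Lemma transfer_cut (I : finType) (D : I -> set R) (t t' : I -> R) :
  (forall i, compact (D i)) ->
  (forall i j d e, D i d -> D j e ->
    (t i + d < t j + e) = (t' i + d < t' j + e)) ->
  forall y, exists y', forall i, same_cut (D i) (y - t i) (y' - t' i).
Proof.
move=> cD tt' y.
pose M := [set p : I * R | D p.1 p.2].
pose s (p : I * R) := t p.1 + p.2; pose s' (p : I * R) := t' p.1 + p.2.
have ss' p q : M p -> M q -> (s p < s q) = (s' p < s' q).
  by move=> ? ?; apply: tt'.
have ssle p q : M p -> M q -> (s p <= s q) = (s' p <= s' q).
  by move=> Mp Mq; rewrite !leNgt ss'.
suff [y' hy'] : exists y', forall p, M p ->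
    (y < s p) = (y' < s' p) /\ (s p < y) = (s' p < y').
  exists y' => i d Dd; have [] := hy' (i, d) Dd; rewrite /s/s'/=.
  by rewrite !ltrBlDl !ltrBrDl.
have [[p Mp ->]|yM] := pselect (exists2 p, M p & y = s p).
  by exists (s' p) => q Mq; rewrite !ss'.
pose U := \big[setU/set0]_(i : I) (+%R (t i) @` D i).
have inU z : U z <-> exists2 p, M p & z = s p.
  rewrite /U -(bigcup_pred predT).
  split=> [[i _ [d Dd <-]]|[[i d] Mp ->]]; first by exists (i, d).
  by exists i => //; exists d.
have cU Z : closed Z -> compact (U `&` Z).
  move=> cZ; apply: compact_closedI cZ; apply: bigsetU_compact => i _.
  apply: continuous_compact (cD i); apply: continuous_subspaceT => x.
  by apply: cvgD; [apply: cvg_cst|apply: cvg_id].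
have cid Z : {within Z, continuous (id : R -> R)}.
  by apply: continuous_subspaceT => x; apply: cvg_id.
have [|||y' [h1 h2]] := @exists_between _ _ (fun p => M p /\ s p < y)
    (fun p => M p /\ y < s p) s' s'.
- move=> [p [Mp spy]].
  have [||c] := @compact_EVT_max _ _ id _ _
    (cU [set z | z <= y] (@closed_le _ _)) => //.
    by exists (s p); split; [apply/inU; exists p|apply: ltW].
  move=> /set_mem [/inU[q Mq ->] /= qy] hq; exists q.
    split=> //; rewrite lt_neqAle qy andbT.
    by apply/eqP => e; apply: yM; exists q.
  move=> k [Mk ky]; rewrite -ssle //; apply: hq; apply: mem_set.
  by split; [apply/inU; exists k|apply: ltW].
- move=> [p [Mp spy]].
  have [||c] := @compact_EVT_min _ _ id _ _
    (cU [set z | y <= z] (@closed_ge _ _)) => //.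
    by exists (s p); split; [apply/inU; exists p|apply: ltW].
  move=> /set_mem [/inU[q Mq ->] /= qy] hq; exists q.
    split=> //; rewrite lt_neqAle qy andbT.
    by apply/eqP => e; apply: yM; exists q.
  move=> k [Mk ky]; rewrite -ssle //; apply: hq; apply: mem_set.
  by split; [apply/inU; exists k|apply: ltW].
- by move=> p q [Mp py] [Mq yq]; rewrite -ss' //; apply: lt_trans yq.
exists y' => p Mp; case: (ltgtP y (s p)) => [yp|py|e]; last first.
- by case: yM; exists p.
- by rewrite h1 //; split=> //; apply/esym/negbTE; rewrite -leNgt ltW // h1.
- by rewrite h2 //; split=> //; apply/esym/negbTE; rewrite -leNgt ltW // h2.
Qed.

(** * Conditions determined by finitely many cuts *)

Definition linear_form (f : (nat -> R) -> R) :=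
  forall c u v, f (fun i => c * u i + v i) = c * f u + f v.

(** The coefficient of the variable of index 0. *)
Definition slope (f : (nat -> R) -> R) := f (scons 1 (fun=> 0)).

Lemma linear_form_scons f y v : linear_form f ->
  f (scons y v) = f (scons 0 v) + y * slope f.
Proof.
move=> lf; rewrite addrC -lf; congr f; apply/funext => -[|i] /=; lra.
Qed.

Definition tame (P : (nat -> R) -> Prop) :=
  exists (I : finType) (f : I -> (nat -> R) -> R) (D : I -> set R),
  [/\ forall i, linear_form (f i), forall i, finite_rank (D i) &
    forall v v', (forall i, same_cut (D i) (f i v) (f i v')) -> P v -> P v'].

Lemma tame_ext (P Q : (nat -> R) -> Prop) :
  (forall v, P v <-> Q v) -> tame P -> tame Q.
Proof. by move=> PQ; have -> : P = Q by apply/funext => v; apply/propext. Qed.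

Lemma tame_atom (P : R -> Prop) f D : linear_form f -> finite_rank D ->
  (forall u u', same_cut D u u' -> P u -> P u') -> tame (fun v => P (f v)).
Proof.
move=> lf rD PD; exists unit, (fun=> f), (fun=> D); split=> // v v' h.
exact: PD (h tt).
Qed.

Lemma tame_imp P Q : tame P -> tame Q -> tame (fun v => P v -> Q v).
Proof.
move=> [I [f [D [lf rD hP]]]] [J [g [C [lg rC hQ]]]].
exists (I + J)%type, (fun k => match k with inl i => f i | inr j => g j end),
  (fun k => match k with inl i => D i | inr j => C j end).
split; [by case|by case|] => v v' h PQ Pv'.
apply: hQ (fun j => h (inr j)) (PQ _).
by apply: hP Pv' => i; apply: same_cut_sym (h (inl i)).
Qed.

(** The cuts of the h_i serve the forms in which y does not occur, the cuts of
    the differences serve the others.  Both are recorded for all indices: since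
    the inverse of 0 is 0, a form of slope 0 only adds the harmless set Dm i,
    contained in {0}, and the form 0 * h_i. *)
Lemma tame_all P : tame P -> tame (fun v => forall y, P (scons y v)).
Proof.
move=> [I [f [D [lf rD hP]]]].
pose h i v := f i (scons 0 v).
pose m i := (slope (f i))^-1.
pose Dm i := [set m i * d | d in D i].
have lh i : linear_form (h i).
  move=> c u v; rewrite /h -lf; congr (f i _).
  by apply/funext => -[|k] /=; rewrite ?mulr0 ?addr0.
exists (I + I * I)%type,
  (fun k => match k with
     inl i => h i | inr (i, j) => fun v => m j * h j v - m i * h i v end),
  (fun k => match k with
     inl i => D i | inr (i, j) => [set d - e | d in Dm j & e in Dm i] end).
have rDm i : finite_rank (Dm i) by apply: finite_rank_scale.
split.
- case=> [i|[i j]]; first exact: lh.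
  by move=> c u v; rewrite !lh; ring.
- by case=> [i|[i j]] //; apply: finite_rankB.
move=> v v' vv' Pv y.
have cDm i : compact (Dm i) by exact: finite_rank_compact.
(* The position of y over v' is realised by some y' over v, where P holds. *)
have [|y' hy'] := @transfer_cut I Dm (fun i => - (m i * h i v'))
    (fun i => - (m i * h i v)) cDm _ y.
  move=> i j d e Dd De.
  have E (b c : R) : (- b + d < - c + e) = (c - b < e - d).
    by apply/idP/idP; lra.
  have [] := vv' (inr (i, j)) (e - d)
    (ex_intro2 _ _ e De (ex_intro2 _ _ d Dd erefl)).
  by rewrite !E.
apply: hP (Pv y') => i; apply: same_cut_sym.
have [s0|s0] := eqVneq (slope (f i)) 0.
  rewrite (linear_form_scons y) // (linear_form_scons y') // s0 !mulr0 !addr0.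
  exact: same_cut_sym (vv' (inl i)).
apply: (@same_cut_scale _ (m i)); first by rewrite invr_eq0.
rewrite (linear_form_scons y) // (linear_form_scons y') //.
have E z w : m i * (h i w + z * slope (f i)) = z - - (m i * h i w).
  by rewrite /m; field.
by rewrite -!/(h i _) !E; apply: hy'.
Qed.

(** The bound N involves the sets D_i only; a change of v merely translates
    them. *)
Lemma tame_line P (e : nat -> R) : tame P ->
  exists2 N : nat, (0 < N)%N & forall v : nat -> R,
    let B := [set y | P (fun i => y * e i + v i)] in
    interior B !=set0 \/ union_of_discrete N B.
Proof.
move=> [I [f [D [lf rD hP]]]].
have [r hr] := choice (fun i => finite_rank_union_of_discrete (rD i)).
(* The value None indexes an empty set, so that the number is positive. *)
exists #|{: option {i : I & 'I_(r i)}}|; first by rewrite card_option.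
move=> v B; pose F i y := y * f i e + f i v.
have FE i y : f i (fun i => y * e i + v i) = F i y by rewrite lf.
have cF i : continuous (F i).
  move=> y; apply: cvgD; last exact: cvg_cst.
  by apply: cvgM; [apply: cvg_id|apply: cvg_cst].
have inj i : f i e != 0 -> injective (F i).
  by move=> e0 x y; rewrite /F => /addIr /mulIf; apply.
have [[y By Dy]|BD] :=
    pselect (exists2 y, B y & forall i, f i e != 0 -> ~ D i (F i y)).
  left; exists y.
  have near_cut i : \forall z \near y, same_cut (D i) (F i y) (F i z).
    have [e0|e0] := eqVneq (f i e) 0; first by near=> z; rewrite /F e0 !mulr0.
    apply: (cF i y (fun u => same_cut (D i) (F i y) u)).
    apply: same_cut_near (Dy _ e0).
    by apply: finite_rank_closed (rD i); exact: norm_hausdorff.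
  have := @filter_forall _ _ _ _ (nbhs_filter y) near_cut.
  by apply: filterS => z yz; apply: hP By => i; rewrite !FE.
right.
pose C i := F i @` B `&` D i.
pose W i := projT1 (cid2 (hr i (C i) (@subIsetr _ _ _))).
have dW i k : discrete_set (W i k) by rewrite /W; case: cid2.
have CW i : C i = \bigcup_k W i k by rewrite /W; case: cid2.
pose V j := if j is Some (existT i k) then
  if f i e == 0 then set0 else F i @^-1` W i k else set0.
suff -> : B = \bigcup_(j : option {i : I & 'I_(r i)}) V j.
  apply: union_of_discrete_fin.
  have d0 : discrete_set (set0 : set R).
    exact: (@isolated_discrete_set _ set0).
  case=> [[i k]|//]; rewrite /V; case: eqVneq => // e0.
  by apply: discrete_set_preimage => //; apply: inj.
apply/seteqP; split=> y.
  move=> By; have [i e0 Dy] : exists2 i, f i e != 0 & D i (F i y).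
    apply: contrapT => nD; apply: BD; exists y => // i e0 Dy.
    by apply: nD; exists i.
  have : C i (F i y) by split=> //; exists y.
  rewrite CW => -[k _ Wk].
  by exists (Some (existT _ i k)) => //=; rewrite (negbTE e0).
move=> [[[i k]|] _] //=; case: eqVneq => // e0 Wy.
have [[z Bz /(inj _ e0) <-] //] : C i (F i y) by rewrite CW; exists k.
Unshelve. all: end_near. Qed.

(** * Formulas over the ordered vector space with a predicate *)

Lemma linear_form_eval (E : set R) (t : term (vs_language R)) :
  linear_form (fun v => Defs.eval (vs_expansion E) v t).
Proof.
elim: t => [i//|g ts IH] c u v.
case: g ts IH => [|/=|r /=] ts IH; first by rewrite /= mulr0 addr0.
  by rewrite !(nth_mktuple _ _ ord0) !(nth_mktuple _ _ ord_max) !IH; ring.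
by rewrite !(nth_mktuple _ _ ord0) !IH; ring.
Qed.

Lemma tame_sat (E K : set R) (phi : formula (vs_language R)) :
  finite_rank K -> E `<=` K -> tame (fun v => sat (vs_expansion E) v phi).
Proof.
move=> rK EK; have lt := linear_form_eval E.
pose ev t v := Defs.eval (vs_expansion E) v t.
have lB t u : linear_form (fun v => ev t v - ev u v).
  by move=> c w v; rewrite /ev !lt; ring.
elim: phi => [|t u|t u|[] ts|p IHp q IHq|p IHp] /=.
- have l0 : linear_form (fun=> 0) by move=> c u v; rewrite mulr0 addr0.
  exact: (@tame_atom (fun=> False) _ _ l0 (finite_rank0 _)).
- apply: (@tame_ext (fun v => ev t v - ev u v = 0)).
    move=> v; split=> [/eqP|tu]; last by rewrite /ev tu subrr.
    by rewrite subr_eq0 => /eqP.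
  apply: (@tame_atom (fun z => z = 0) _ _ (lB t u) (finite_rank1 0)).
  by move=> z z' /same_cut_mem h z0; rewrite h.
- apply: (@tame_ext (fun v => ev t v - ev u v < 0)).
    by move=> v; rewrite subr_lt0.
  apply: (@tame_atom (fun z => z < 0) _ _ (lB t u) (finite_rank1 0)).
  by move=> z z' /(_ 0 erefl) [->].
- apply: (@tame_ext (fun v => E (ev (ts ord0) v))).
    by move=> v; rewrite (nth_mktuple _ _ ord0).
  apply: (@tame_atom E _ _ (lt (ts ord0)) rK).
  by move=> z z' /same_cut_mem h Ez; rewrite h //; apply: EK.
- exact: tame_imp IHp IHq.
- exact: tame_all IHp.
Qed.

End Cuts.

Theorem theorem1p2 (R : realType) (a : nat -> R) (ha : cauchy (a @ \oo))
    (E : set R) (hE : E = [set a n | n in [set: nat]]) :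
  dminimal (vs_expansion E).
Proof.
have /cauchy_cvgP/cvg_ex[l al] := ha.
move=> n A [phi [p Aphi]].
have tphi : tame (fun v => sat (vs_expansion E) v phi).
  apply: tame_sat (finite_rank_cvg_range al) _.
  by rewrite hE => x; right.
(* The last coordinate of a point of A is the variable of index n. *)
have [N N0 hN] := tame_line (fun i => (i == n)%:R) tphi.
exists N => // x.
have assignE y : assign [tuple of rcons x y] p =
    (fun i => y * (i == n)%:R + assign [tuple of rcons x 0] p i).
  apply/funext => i; rewrite /assign !nth_rcons size_tuple.
  by case: ltngtP; rewrite ?mulr0 ?mulr1 ?add0r ?addr0.
suff -> : fiber A x = [set y | sat (vs_expansion E)
    (fun i => y * (i == n)%:R + assign [tuple of rcons x 0] p i) phi].
  exact: hN.
by apply/funext => y; apply/propext; rewrite /fiber /= Aphi assignE.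
Qed.
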